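(* When $\mathrm{CFS}_0\ll\widetilde d_0$ and $\mathrm{CFS}_1\gg\widetilde d_{r-1}$, for all $n_{\mathrm{cp}}<r-1$, the $(2r-1)$th-order MOP-WENO-ACM$k$ scheme can achieve the optimal convergence rate of accuracy if the mapping function $g^{\mathrm{MOP-ACM}k}(\omega)$ is applied to the weights of the $(2r-1)$th-order WENO-JS scheme.
   Context: Setting: finite volume WENO schemes on uniform cells $I_j=[x_{j-1/2},x_{j+1/2}]$ of size $\Delta x$ for hyperbolic conservation laws. A $(2r-1)$th-order WENO scheme uses a $(2r-1)$-point global stencil centered around $x_j$, subdivided into $r$-point substencils $S_0,\dots,S_{r-1}$, and approximates $u(x_{j+1/2})$ by $u_{j+1/2}=\sum_{s=0}^{r-1}\omega_s u^s_{j+1/2}$, where $u^s_{j+1/2}$ is the approximation of $u(x_{j+1/2})$ from the cell averages on $S_s$ and $\omega_s$ is the nonlinear weight of $S_s$. The ideal weights $d_0,\dots,d_{r-1}$ are the constants for which $\sum_s d_s u^s_{j+1/2}$ is the $(2r-1)$th-order approximation of $u(x_{j+1/2})$ in smooth regions. The optimal convergence rate of the $(2r-1)$th-order scheme is order $2r-1$; the statement concerns smooth regions of the solution. WENO-JS weights: $\omega_s^{\mathrm{JS}}=\alpha_s^{\mathrm{JS}}/\sum_l\alpha_l^{\mathrm{JS}}$, $\alpha_s^{\mathrm{JS}}=d_s/(\epsilon+\beta_s)^2$, with $\epsilon$ a small positive number preventing a zero denominator and $\beta_s$ the Jiang–Shu smoothness indicator of $S_s$. For $r=3$: $S_s=\{I_{j+s-2},I_{j+s-1},I_{j+s}\}$,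 $d_0=0.1$, $d_1=0.6$, $d_2=0.3$, and, with cell averages $\bar u_i$, $\beta_0=\frac{13}{12}(\bar u_{j-2}-2\bar u_{j-1}+\bar u_j)^2+\frac14(\bar u_{j-2}-4\bar u_{j-1}+3\bar u_j)^2$, $\beta_1=\frac{13}{12}(\bar u_{j-1}-2\bar u_j+\bar u_{j+1})^2+\frac14(\bar u_{j-1}-\bar u_{j+1})^2$, $\beta_2=\frac{13}{12}(\bar u_j-2\bar u_{j+1}+\bar u_{j+2})^2+\frac14(3\bar u_j-4\bar u_{j+1}+\bar u_{j+2})^2$. Critical points: $n_{\mathrm{cp}}$ is the order of the critical point; $n_{\mathrm{cp}}=1$ corresponds to $f'=0,f''\ne0$; $n_{\mathrm{cp}}=2$ corresponds to $f'=0,f''=0,f'''\neq0$; etc. Mapping function: let $\widetilde d_0<\widetilde d_1<\cdots<\widetilde d_{r-1}$ be the ideal weights sorted in ascending order, $0<\mathrm{CFS}_0\le\widetilde d_0$, $\widetilde d_{r-1}\le\mathrm{CFS}_1\le1$, $k_0\in[0,\widetilde d_0/\mathrm{CFS}_0]$, $k_1\in[0,(1-\widetilde d_{r-1})/(1-\mathrm{CFS}_1)]$. Put $\hat\Omega_1=[0,\mathrm{CFS}_0)$, $\hat\Omega_2=[\mathrm{CFS}_0,\frac{\widetilde d_0+\widetilde d_1}{2})$, $\hat\Omega_{i+2}=[\frac{\widetilde d_{i-1}+\widetilde d_i}{2},\frac{\widetilde d_i+\widetilde d_{i+1}}{2})$ for $1\le i\le r-2$, $\hat\Omega_{r+1}=[\frac{\widetilde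 d_{r-2}+\widetilde d_{r-1}}{2},\mathrm{CFS}_1]$, $\hat\Omega_{r+2}=(\mathrm{CFS}_1,1]$, and $$g^{\mathrm{MOP-ACM}k}(\omega)=\begin{cases}k_0\,\omega,&\omega\in\hat\Omega_1,\\ \widetilde d_i,&\omega\in\hat\Omega_{i+2},\ i=0,\dots,r-1,\\ 1-k_1(1-\omega),&\omega\in\hat\Omega_{r+2}.\end{cases}$$ MOP-WENO-ACM$k$ scheme: the WENO scheme whose nonlinear weights are $\omega_s^{\mathrm{MOP-ACM}k}=\alpha_s/\sum_{l=0}^{r-1}\alpha_l$ with $\alpha_s=g^{\mathrm{MOP-ACM}k}(\omega_s^{\mathrm{JS}})$. The symbols $\ll$ and $\gg$ (''much smaller/larger than'') are used informally, without further quantification. *)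

(* Defs.v *)
From HB Require Import structures.
From mathcomp Require Import all_boot all_order all_algebra.
From mathcomp Require Import all_classical all_reals all_analysis.
Set Implicit Arguments.
Unset Strict Implicit.
Unset Printing Implicit Defensive.
Import Order.TTheory GRing.Theory Num.Theory.
Import numFieldNormedType.Exports.
Local Open Scope classical_set_scope.
Local Open Scope ring_scope.

(* MathComp-Analysis is used throughout.
   A cell I_j of a uniform grid is given by its centre x = x_j and the cell
   size h; the other cells are addressed relative to it, so that k : int stands
   for I_{j+k}.  Data on the grid are functions v : int -> R, with v k standing
   for the cell average over I_{j+k}. *)

Section Weno.
Variable R : realType.
Implicit Types (x h eps : R) (v : int -> R) (u : R -> R) (r n : nat).

Definition cell x h (k : int) : set R :=
  `[x + (k%:~R - 2^-1) * h, x + (k%:~R + 2^-1) * h].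

Definition cell_average x h u (k : int) : R :=
  h^-1 * \int[lebesgue_measure]_(y in cell x h k) u y.

(* p has degree <= n - 1 and the averages v on the n cells I_{j+a}, ...,
   I_{j+a+n-1} *)
Definition reconstructs x h (a : int) n v (p : {poly R}) : Prop :=
  (size p <= n)%N /\
  forall i : 'I_n,
    cell_average x h (fun y => p.[y]) (a + i%:Z) = v (a + i%:Z).

(* For h > 0 there is exactly one such polynomial; 0 is a dummy default. *)
Definition reconstruction x h (a : int) n v : {poly R} :=
  xget 0 [set p | reconstructs x h a n v p].

(* S_s = {I_{j+s-r+1}, ..., I_{j+s}} *)
Definition substencil_poly x h r v (s : 'I_r) : {poly R} :=
  reconstruction x h (s%:Z - r%:Z + 1) r v.

(* the global stencil {I_{j-r+1}, ..., I_{j+r-1}} *)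
Definition stencil_poly x h r v : {poly R} :=
  reconstruction x h (1 - r%:Z) (2 * r - 1) v.

Definition substencil_value x h r v (s : 'I_r) : R :=
  (substencil_poly x h v s).[x + h / 2].

Definition ideal_weights r (d : 'I_r -> R) : Prop :=
  forall x h v, 0 < h ->
    \sum_(s < r) d s * substencil_value x h v s
      = (stencil_poly x h r v).[x + h / 2].

(* Jiang-Shu: the sum over l of
   h^(2l-1) times the integral over I_j of the square of p_s^(l) *)
Definition smoothness_indicator x h r v (s : 'I_r) : R :=
  \sum_(1 <= l < r)
    h ^+ (2 * l - 1) *
    \int[lebesgue_measure]_(y in cell x h 0)
      ((derivn l (substencil_poly x h v s)).[y] ^+ 2).

Definition normalize_weights r (alpha : 'I_r -> R) (s : 'I_r) : R :=
  alpha s / \sum_(l < r) alpha l.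

Definition js_weights r (d : 'I_r -> R) eps x h v : 'I_r -> R :=
  normalize_weights
    (fun s : 'I_r => d s / (eps + smoothness_indicator x h v s) ^+ 2).

Definition sorted_weights r (d : 'I_r -> R) : seq R :=
  sort <=%R [seq d s | s <- enum 'I_r].

Section Mapping.
Variables (r : nat) (dt : seq R) (CFS0 CFS1 k0 k1 : R).

Let midpoint (i : nat) : R := (dt`_i + dt`_i.+1) / 2.

(* The interval on which the mapping takes the value dt`_i *)
Definition acm_plateau (i : nat) : interval R :=
  Interval (if i == 0%N then BLeft CFS0 else BLeft (midpoint i.-1))
           (if i == r.-1 then BRight CFS1 else BLeft (midpoint i)).

(* Meaningful on [0, 1], which is covered by `[0, CFS0[, the plateaus and
   `]CFS1, 1]; outside [0, 1] the values are irrelevant. *)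
Definition acm_map (w : R) : R :=
  if w < CFS0 then k0 * w
  else if [pick i : 'I_r | w \in acm_plateau i] is Some i then dt`_i
  else 1 - k1 * (1 - w).

End Mapping.

Definition acm_weights r (d : 'I_r -> R) (CFS0 CFS1 k0 k1 eps : R) x h v :
    'I_r -> R :=
  normalize_weights
    (fun s : 'I_r =>
      acm_map r (sorted_weights d) CFS0 CFS1 k0 k1 (js_weights d eps x h v s)).

Definition weno_value x h r v (omega : 'I_r -> R) : R :=
  \sum_(s < r) omega s * substencil_value x h v s.

(* The value u_{j+1/2} computed by the MOP-WENO-ACMk scheme from the exact cell
   averages of u *)
Definition mop_weno_acmk r (d : 'I_r -> R) (CFS0 CFS1 k0 k1 eps : R) u x h : R :=
  let v := cell_average x h u in
  weno_value x h v (acm_weights d CFS0 CFS1 k0 k1 eps x h v).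

(* u is of class C^n in a neighbourhood of x0 *)
Definition smooth_near n u (x0 : R) : Prop :=
  \forall y \near x0,
    (forall k, (k < n)%N -> derivable (derive1n k u) y 1) /\
    {for y, continuous (derive1n n u)}.

(* For ncp = 0 this says that x0 is not a critical point. *)
Definition critical_point_order u (x0 : R) (ncp : nat) : Prop :=
  (forall k, (1 <= k <= ncp)%N -> derive1n k u x0 = 0) /\
  derive1n ncp.+1 u x0 != 0.

End Weno.

(* Main.v *)
Require Import Defs.
From mathcomp Require Import all_boot all_order all_algebra.
From mathcomp Require Import all_classical all_reals all_analysis.
From mathcomp Require Import ring lra zify.
Set Implicit Arguments.
Unset Strict Implicit.
Unset Printing Implicit Defensive.
Import Order.TTheory GRing.Theory Num.Theory.
Import numFieldNormedType.Exports.
Local Open Scope classical_set_scope.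
Local Open Scope ring_scope.

(** The mapping function is piecewise constant near the ideal weights: since
   CFS0 < min d and max d < CFS1, every ideal weight d_s lies in the interior of
   the plateau on which the map takes the value d_s.  Hence as soon as the
   WENO-JS weights are close enough to the ideal ones, the mapped weights are
   equal to the ideal ones, and the scheme evaluates the polynomial
   reconstruction on the whole (2r-1)-cell stencil, whose error is
   O(h^(2r-1)) by Taylor expansion.

   It remains to see that the WENO-JS weights tend to the ideal weights as
   (h, x) tends to (0, x0), uniformly in eps.  For this the indicators beta_s
   must become proportionally equal: all of them must lie between (1 - dl) B and
   (1 + dl) B for a common B > 0.  In the variable t = (y - x) / h, every
   substencil polynomial is T + E_s, where T is the Taylor polynomial of u at x
   with r terms and E_s = O(h^r), because reconstruction is linear, reproduces
   polynomials of degree < r, and is stable with a constant that is independent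
   of x and h (reconstruction_taylor).  In this variable beta_s is the square of
   a seminorm of T + E_s (smoothness_indicator_rescale), and B is the square of
   the seminorm of T.  The derivative of order ncp + 1 of u does not vanish near
   x0, so B is at least a constant times h^(2(ncp+1)) (taylor_derivn_ge); as
   ncp + 1 < r, this dominates the contribution O(h^(2r)) of E_s
   (smoothness_indicators_close).  The derivatives of orders 1 to ncp vanish at
   x0 but need not vanish at nearby points x, which is why B is kept as a common
   reference instead of being expanded in h. *)

(** * Polynomials and cell averages *)

Section PolynomialAverages.
Variable R : realType.
Implicit Types (x h c : R) (p q P Q : {poly R}) (k : int) (v : int -> R).

(** At i = 0 the division is by 0, so the constant term is 0. *)
Definition antideriv p : {poly R} := \poly_(i < (size p).+1) (p`_i.-1 / i%:R).

Lemma antiderivK p : (antideriv p)^`() = p.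
Proof.
apply/polyP => i; rewrite coef_deriv coef_poly ltnS /=.
case: ltnP => [_|hi]; last by rewrite mul0rn nth_default.
by rewrite -[LHS]mulr_natr mulfVK // pnatr_eq0.
Qed.

Lemma size_antideriv n p : (size p <= n)%N -> (size (antideriv p) <= n.+1)%N.
Proof. by move=> hp; apply: leq_trans (size_poly _ _) _. Qed.

Lemma Rintegral_deriv Q (a b : R) : a < b ->
  \int[lebesgue_measure]_(y in `[a, b]) (Q^`()).[y] = Q.[b] - Q.[a].
Proof.
move=> ab; rewrite /Rintegral (@continuous_FTC2 _ _ (horner Q)) //.
- by apply: continuous_subspaceT; exact: continuous_horner.
- have cQ : {within `[a, b], continuous (horner Q)}.
    by apply: continuous_subspaceT; exact: continuous_horner.
  have [_ ? ?] := (continuous_within_itvP _ ab).1 cQ.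
  by split => // y _; exact: (@ex_derive _ _ _ _ _ _ _ (is_derive_poly Q y)).
- by move=> y _; rewrite derive1E (@derive_val _ _ _ _ _ _ _ (is_derive_poly Q y)).
Qed.

Lemma cell_average_deriv x h Q k : 0 < h ->
  cell_average x h (horner Q^`()) k =
  (Q.[x + (k%:~R + 2^-1) * h] - Q.[x + (k%:~R - 2^-1) * h]) / h.
Proof.
move=> h0; rewrite /cell_average Rintegral_deriv; first by rewrite mulrC.
by rewrite ltrD2l ltr_pM2r //; lra.
Qed.

Lemma cell_averageE x h p k : 0 < h ->
  cell_average x h (horner p) k =
  ((antideriv p).[x + (k%:~R + 2^-1) * h]
   - (antideriv p).[x + (k%:~R - 2^-1) * h]) / h.
Proof. by move=> h0; rewrite -cell_average_deriv // antiderivK. Qed.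

(** Integrals are traded for antiderivatives, so that no integrability argument
   is needed for polynomials. *)
Lemma cell_average_lincomb (I : finType) (c : I -> R) (P : I -> {poly R}) x h k :
  0 < h -> cell_average x h (horner (\sum_i c i *: P i)) k =
  \sum_i c i * cell_average x h (horner (P i)) k.
Proof.
move=> h0.
have -> : \sum_i c i *: P i = (\sum_i c i *: antideriv (P i))^`().
  by rewrite raddf_sum; apply: eq_bigr => i _; rewrite /= derivZ antiderivK.
rewrite cell_average_deriv // !horner_sum -sumrB big_distrl /=.
apply: eq_bigr => i _; rewrite cell_averageE // !hornerZ; ring.
Qed.

(** P is written in the cell variable t = (y - x) / h; its rescaling is the same
   function of the physical variable y. *)
Definition rescale x h P : {poly R} := P \Po (h^-1 *: ('X - x%:P)).

Lemma horner_rescale x h P t : h != 0 -> (rescale x h P).[x + t * h] = P.[t].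
Proof.
move=> h0; rewrite horner_comp !hornerE; congr (_.[_]).
by field.
Qed.

Lemma size_rescale x h P : h != 0 -> size (rescale x h P) = size P.
Proof.
move=> h0; rewrite size_comp_poly2 // size_scale ?invr_eq0 //.
exact: size_XsubC.
Qed.

Lemma derivn_rescale x h P l :
  (rescale x h P)^`(l) = h ^- l *: rescale x h P^`(l).
Proof.
elim: l => [|l IH]; first by rewrite expr0 invr1 scale1r.
rewrite derivnS IH derivZ deriv_comp derivZ derivXsubC -derivnS.
rewrite -scalerAr mulr1 scalerA exprSr invfM; congr (_ *: _).
Qed.

Lemma cell_average_rescale x h P k : 0 < h ->
  cell_average x h (horner (rescale x h P)) k = cell_average 0 1 (horner P) k.
Proof.
move=> h0; have hn0 : h != 0 by rewrite gt_eqF.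
have -> : rescale x h P = (h *: rescale x h (antideriv P))^`().
  rewrite derivZ -derivn1 derivn_rescale scalerA expr1 mulfV // scale1r.
  by rewrite derivn1 antiderivK.
rewrite cell_average_deriv // cell_averageE // !hornerZ !horner_rescale //.
by rewrite !add0r !mulr1 divr1 -mulrBr mulrC mulKf.
Qed.

(** The edges of the cells: the i-th node is the left edge of the cell a + i. *)
Definition node x h (a : int) (i : nat) : R := x + ((a + i%:Z)%:~R - 2^-1) * h.

Lemma node_inj x h a : 0 < h -> injective (node x h a).
Proof.
move=> h0 i j /addrI /(mulIf (lt0r_neq0 h0)) /addIr /eqP.
by rewrite eqr_int => /eqP /addrI [].
Qed.

Lemma cell_average_node x h a i Q : 0 < h ->
  cell_average x h (horner Q^`()) (a + i%:Z) =
  (Q.[node x h a i.+1] - Q.[node x h a i]) / h.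
Proof.
move=> h0; rewrite cell_average_deriv //; congr ((_.[_] - _) / _).
have -> // : node x h a i.+1 = x + ((a + i%:Z)%:~R + 2^-1) * h.
rewrite /node intS [1 + _]addrC addrA [(a + _ + 1)%:~R]rmorphD /=.
by congr (x + _ * h); lra.
Qed.

(** The antiderivative of p - q takes the same value at the n + 1 edges of the n
   cells, and its degree is at most n; so it is constant. *)
Lemma cell_averages_inj x h a n p q : 0 < h ->
  (size p <= n)%N -> (size q <= n)%N ->
  (forall i : 'I_n, cell_average x h (horner p) (a + i%:Z)
                  = cell_average x h (horner q) (a + i%:Z)) ->
  p = q.
Proof.
move=> h0 sp sq e.
pose D := antideriv p - antideriv q.
have DE i : (i < n)%N -> D.[node x h a i.+1] = D.[node x h a i].
  move=> hi; have := e (Ordinal hi).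
  rewrite -{1}[p]antiderivK -{1}[q]antiderivK.
  rewrite !cell_average_node // => /(mulIf (invr_neq0 (lt0r_neq0 h0))) /= H.
  by rewrite /D !hornerE; lra.
have D0 i : (i < n.+1)%N -> D.[node x h a i] = D.[node x h a 0].
  by elim: i => // i IH hi; rewrite DE // IH // ltnW.
have : D - (D.[node x h a 0])%:P = 0.
  rewrite [LHS](lagrange_gen (ltn0Sn n) (@node_inj x h a h0)).
    apply: big1 => i _; rewrite hornerD hornerN hornerC D0 // subrr.
    by rewrite polyC0 mul0r.
  apply: leq_trans (size_polyD _ _) _; rewrite geq_max size_polyN.
  rewrite (leq_trans (size_polyC_leq1 _)) // andbT.
  by apply: leq_trans (size_polyD _ _) _; rewrite geq_max size_polyN !size_antideriv.
move/(congr1 (@deriv R)); rewrite derivB derivC subr0 deriv0 derivB !antiderivK.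
by move/eqP; rewrite subr_eq0 => /eqP.
Qed.

(** The reconstruction is the derivative of the polynomial that interpolates, at
   the n + 1 edges, the running sums of h times the prescribed averages. *)
Lemma reconstructs_exists x h a n v : 0 < h ->
  exists p, reconstructs x h a n v p.
Proof.
move=> h0; have nI := @node_inj x h a h0.
pose c (i : nat) := h * \sum_(k < i) v (a + k%:Z).
pose Q : {poly R} :=
  \sum_(i < n.+1) c i *: (tnth (n.+1.-lagrange (node x h a)) i : {poly R}).
have QE i : (i < n.+1)%N -> Q.[node x h a i] = c i.
  move=> hi; rewrite horner_sum (bigD1 (Ordinal hi)) //= hornerZ.
  rewrite (lagrange_sample _ nI _ (Ordinal hi)) // eqxx mulr1 big1 ?addr0 // => j jn.
  by rewrite hornerZ (lagrange_sample _ nI _ (Ordinal hi)) // (negbTE jn) mulr0.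
exists Q^`(); split.
  have [->|Q0] := eqVneq Q 0; first by rewrite deriv0 size_poly0.
  rewrite -ltnS; apply: leq_trans (lt_size_deriv Q0) _.
  apply: (leq_trans (size_sum _ _ _)); apply/bigmax_leqP => i _.
  apply: leq_trans (size_scale_leq _ _) _; exact: size_npoly.
move=> i; rewrite cell_average_node // !QE ?ltnS // 1?ltnW // /c big_ord_recr /=.
by rewrite mulrDr addrC addKr mulrC mulKf // gt_eqF.
Qed.

Lemma reconstructionP x h a n v : 0 < h ->
  reconstructs x h a n v (reconstruction x h a n v).
Proof.
move=> /(reconstructs_exists x a n v)[p hp]; exact: (xgetPex _ (ex_intro _ p hp)).
Qed.

Lemma reconstruction_eq x h a n v p : 0 < h ->
  reconstructs x h a n v p -> reconstruction x h a n v = p.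
Proof.
move=> h0 [sp hp]; have [sr hr] := reconstructionP x a n v h0.
by apply: (cell_averages_inj h0 sr sp) => i; exact: etrans (hr i) (esym (hp i)).
Qed.

Lemma reconstruction_poly x h a n p : 0 < h -> (size p <= n)%N ->
  reconstruction x h a n (cell_average x h (horner p)) = p.
Proof. by move=> h0 sp; apply: reconstruction_eq. Qed.

(** The basis of polynomials of degree < n that is dual to the averages over the
   unit cells a, ..., a + n - 1; it depends on neither x nor h, hence the uniform
   stability of reconstructions. *)
Definition fundamental (a : int) n (i : 'I_n) : {poly R} :=
  reconstruction 0 1 a n (fun k => (k == a + i%:Z)%:R).

Lemma cell_average_fundamental a n (i j : 'I_n) :
  cell_average 0 1 (horner (fundamental a i)) (a + j%:Z) = (i == j)%:R.
Proof.
have [_ /(_ j)] := reconstructionP 0 a n (fun k => (k == a + i%:Z)%:R) ltr01.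
by rewrite (inj_eq (addrI a)) eqz_nat eq_sym.
Qed.

Definition fundamental_sum a n v : {poly R} :=
  \sum_(i < n) v (a + i%:Z) *: fundamental a i.

Lemma reconstruction_rescale x h a n v : 0 < h ->
  reconstruction x h a n v = rescale x h (fundamental_sum a n v).
Proof.
move=> h0; apply: reconstruction_eq => //; split.
  rewrite size_rescale ?gt_eqF //.
  apply: (leq_trans (size_sum _ _ _)); apply/bigmax_leqP => i _.
  apply: leq_trans (size_scale_leq _ _) _.
  by case: (reconstructionP 0 a n (fun k => (k == a + i%:Z)%:R) ltr01).
move=> i; rewrite cell_average_rescale // cell_average_lincomb //.
rewrite (bigD1 i) //= cell_average_fundamental eqxx mulr1 big1 ?addr0 // => j ji.
by rewrite cell_average_fundamental (negbTE ji) mulr0.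
Qed.

Lemma fundamental_sum_poly a n P : (size P <= n)%N ->
  fundamental_sum a n (cell_average 0 1 (horner P)) = P.
Proof.
move=> sP; rewrite -[RHS](reconstruction_poly 0 a ltr01 sP).
rewrite reconstruction_rescale // /rescale invr1 scale1r polyC0 subr0.
by rewrite comp_polyXr.
Qed.

(** Reconstruction is linear and reproduces P, so it differs from P by the
   reconstruction of the discrepancy of the averages. *)
Lemma reconstruction_perturb x h a n v P : 0 < h -> (size P <= n)%N ->
  reconstruction x h a n v = rescale x h (P + fundamental_sum a n
    (fun k => v k - cell_average x h (horner (rescale x h P)) k)).
Proof.
move=> h0 sP; rewrite reconstruction_rescale //; congr (rescale _ _ _).
rewrite -[P in P + _](fundamental_sum_poly a sP) -big_split /=.
apply: eq_bigr => i _; rewrite -scalerDl; congr (_ *: _).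
by rewrite /= cell_average_rescale //; ring.
Qed.

End PolynomialAverages.

(** * Taylor expansion *)

Section Taylor.
Variable R : realType.
Implicit Types (x h y : R) (u f : R -> R) (n k : nat).

(** The Taylor polynomial of u at x with n terms, in the variable
   t = (y - x) / h. *)
Definition taylor n u x h : {poly R} :=
  \poly_(k < n) (derive1n k u x / k`!%:R * h ^+ k).

(** Undoing the scaling by h removes the powers of h. *)
Lemma horner_taylor n u x h y : h != 0 ->
  (rescale x h (taylor n u x h)).[y] =
  (rescale x 1 (taylor n u x 1)).[y].
Proof.
move=> h0; have -> : y = x + (y - x) / h * h by field.
rewrite horner_rescale // -[_ * h]mulr1 horner_rescale ?oner_eq0 //.
rewrite !horner_poly; apply: eq_bigr => k _; move: (_ / h) => t.
by rewrite expr1n mulr1 exprMn; ring.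
Qed.

Lemma derive1nSr k u : derive1n k (derive1 u) = derive1n k.+1 u.
Proof. by rewrite /derive1n iterSr. Qed.

Lemma deriv_taylor n u x :
  (taylor n.+1 u x 1)^`() = taylor n (derive1 u) x 1.
Proof.
apply/polyP => k; rewrite coef_deriv !coef_poly ltnS; case: ifP => _; last first.
  by rewrite mul0rn.
rewrite !expr1n !mulr1 derive1nSr -[LHS]mulr_natr factS natrM invfM.
by rewrite mulrC mulrCA mulVKf // pnatr_eq0.
Qed.

(** Induction on n: the derivative of the remainder is the remainder of the
   derivative, and the mean value theorem gains one factor |y - x|.  The factor
   1 / n! is given up, which lets a single bound on the derivatives serve every
   order. *)
Lemma taylor_remainder n u x0 d M :
  (forall k y, (k < n)%N -> `|y - x0| < d -> derivable (derive1n k u) y 1) ->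
  (forall y, `|y - x0| < d -> `|derive1n n u y| <= M) ->
  forall x y, `|x - x0| < d -> `|y - x0| < d ->
  `|u y - (rescale x 1 (taylor n u x 1)).[y]| <= M * `|y - x| ^+ n.
Proof.
elim: n u => [|n IH] u du bu x y hx hy.
  rewrite expr0 mulr1 /rescale (_ : taylor _ _ _ _ = 0) ?comp_poly0 ?horner0 ?subr0.
    exact: (bu y).
  by apply/polyP => i; rewrite coef_poly coef0.
have M0 : 0 <= M by apply: le_trans (bu x hx).
pose p := rescale x 1 (taylor n.+1 u x 1).
have dp : p^`() = rescale x 1 (taylor n (derive1 u) x 1).
  by rewrite -deriv_taylor -!derivn1 derivn_rescale expr1 invr1 scale1r.
pose g z := u z - p.[z].
have dg z : `|z - x0| < d -> is_derive z 1 g (derive1 u z - p^`().[z]).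
  move=> hz; apply: is_deriveB.
  by rewrite derive1E; apply/derivableP; exact: (du 0%N).
have bdg z : `|z - x0| < d -> `|derive1 u z - p^`().[z]| <= M * `|z - x| ^+ n.
  move=> hz; rewrite dp; apply: IH => //.
  - by move=> k w hk hw; rewrite derive1nSr; exact: (du k.+1).
  - by move=> w hw; rewrite derive1nSr; exact: (bu w).
have gx : g x = 0.
  have := horner_rescale x (taylor n.+1 u x 1) 0 (oner_neq0 R).
  rewrite mul0r addr0 /g /p => ->.
  rewrite horner_coef0 coef_poly /= expr0 mulr1 fact0 divr1.
  by rewrite subrr.
have seg a b z : `|a - x0| < d -> `|b - x0| < d -> z \in `[a, b] -> `|z - x0| < d.
  by rewrite in_itv /= !ltr_norml => ? ? ?; lra.
have key a b : `|a - x0| < d -> `|b - x0| < d -> a <= b ->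
    exists2 c, c \in `[a, b] & g b - g a = (derive1 u c - p^`().[c]) * (b - a).
  move=> ha hb ab; apply: MVT_segment => //.
    by move=> z /subset_itv_oo_cc hz; apply: dg; apply: seg hz.
  apply: derivable_within_continuous => z hz.
  by have [] := dg z (seg _ _ _ ha hb hz).
have fin z : `|z - x0| < d -> `|z - x| <= `|y - x| ->
   `|derive1 u z - p^`().[z]| * `|y - x| <= M * `|y - x| ^+ n.+1.
  move=> hz zy; rewrite exprSr mulrA ler_wpM2r //.
  by apply: le_trans (bdg z hz) _; rewrite ler_wpM2l // lerXn2r // nnegrE.
rewrite -/(g y).
have [xy|yx] := leP x y.
  have [c hc] := key x y hx hy xy.
  rewrite gx subr0 => ->; rewrite normrM; apply: fin; first exact: seg hc.
  by move: hc; rewrite in_itv /= => hc; rewrite !ger0_norm; lra.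
have [c hc] := key y x hy hx (ltW yx).
rewrite gx sub0r => /eqP; rewrite eqr_oppLR => /eqP ->.
rewrite normrN normrM distrC [`|x - y|]distrC -[`|_ - derive1 u c|]distrC.
apply: fin; first exact: seg hc.
move: hc; rewrite in_itv /= => hc; rewrite !ler0_norm; lra.
Qed.

Lemma smooth_near_bounded n u x0 : smooth_near n u x0 ->
  exists d M, [/\ 0 < d, 0 < M,
    forall k y, (k < n)%N -> `|y - x0| < d -> derivable (derive1n k u) y 1 &
    forall k y, (k <= n)%N -> `|y - x0| < d -> `|derive1n k u y| <= M].
Proof.
move=> sn.
have cn (k : 'I_n.+1) : {for x0, continuous (derive1n k u)}.
  have [dk cn] := nbhs_singleton sn.
  have := ltn_ord k; rewrite ltnS leq_eqVlt => /orP[/eqP -> //|kn].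
  by apply: differentiable_continuous; apply/derivable1_diffP; exact: dk.
have bn : \forall y \near x0, forall k : 'I_n.+1,
    `|derive1n k u x0 - derive1n k u y| < 1.
  apply: (@filter_forall _ _ (fun (k : 'I_n.+1) y =>
    `|derive1n k u x0 - derive1n k u y| < 1) _ (nbhs_filter x0)) => k.
  by move/cvgrPdist_lt : (cn k); apply.
have /nbhs_ballP[d /= d0 hd] := @filterI _ _ (nbhs_filter x0) _ _ sn bn.
exists d, (\sum_(k < n.+1) `|derive1n k u x0| + 1); split => //.
- by rewrite ltr_wpDl // sumr_ge0.
- by move=> k y kn; rewrite distrC => /hd[[+ _] _]; exact.
move=> k y; rewrite -ltnS distrC => kn /hd[_ /(_ (Ordinal kn)) /= yk].
have -> : derive1n k u y = derive1n k u x0 - (derive1n k u x0 - derive1n k u y).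
  by ring.
apply: le_trans (ler_normB _ _) _; apply: lerD (ltW yk).
by rewrite (bigD1 (Ordinal kn)) //= lerDl sumr_ge0.
Qed.

End Taylor.

(** * Smoothness indicators as seminorms *)

Section Seminorm.
Variable R : realType.
Implicit Types (x h y t c M K : R) (u : R -> R) (n l r : nat) (p P Q T E : {poly R}).

Lemma cell_average_dist x h k u p M : 0 < h ->
  (forall y, cell x h k y -> derivable u y 1) ->
  (forall y, cell x h k y -> `|u y - p.[y]| <= M) ->
  `|cell_average x h u k - cell_average x h (horner p) k| <= M.
Proof.
move=> h0 du ub.
have mc : measurable (cell x h k : set (measurableTypeR R)) by exact: measurable_itv.
have cc : compact (cell x h k) by exact: segment_compact.
have iu : lebesgue_measure.-integrable (cell x h k) (EFin \o u).
  apply: continuous_compact_integrable => //.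
  by apply: derivable_within_continuous => y hy; apply: du.
have ip : lebesgue_measure.-integrable (cell x h k) (EFin \o horner p).
  apply: continuous_compact_integrable => //.
  by apply: continuous_subspaceT; exact: continuous_horner.
have iup : lebesgue_measure.-integrable (cell x h k) (EFin \o (fun y => u y - p.[y])).
  apply: continuous_compact_integrable => //.
  apply: derivable_within_continuous => y hy; apply: derivableB; first exact: du.
  exact: (@ex_derive _ _ _ _ _ _ _ (is_derive_poly p y)).
have iM : lebesgue_measure.-integrable (cell x h k) (EFin \o cst M).
  apply: continuous_compact_integrable => //.
  by apply: continuous_subspaceT; exact: cst_continuous.
rewrite /cell_average -mulrBr -RintegralB // normrM gtr0_norm ?invr_gt0 //.
rewrite mulrC ler_pdivrMr //.
apply: le_trans (le_normr_Rintegral mc iup) _.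
apply: le_trans (_ : \int[lebesgue_measure]_(y in cell x h k) M <= _).
  apply: le_Rintegral => //.
  exact: (integrable_norm iup).
rewrite Rintegral_cst // [fine _](_ : _ = h) //.
suff /(congr1 fine) : lebesgue_measure (cell x h k) = h%:E by [].
rewrite lebesgue_measure_itv /= lte_fin ltrD2l ltr_pM2r //.
by rewrite ifT; [rewrite -EFinD /=; congr (_%:E); lra|lra].
Qed.

Lemma cell_averageZ x h c p k : 0 < h ->
  cell_average x h (horner (c *: p)) k = c * cell_average x h (horner p) k.
Proof.
move=> h0; have -> : c *: p = (c *: antideriv p)^`() by rewrite derivZ antiderivK.
rewrite cell_average_deriv // !cell_averageE // !hornerZ; ring.
Qed.

(** The integral over [-1/2, 1/2], that is, over the cell of a unit grid. *)
Definition cell0_average p : R := cell_average 0 1 (horner p) 0.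

Lemma cell0_averageD p Q : cell0_average (p + Q) = cell0_average p + cell0_average Q.
Proof.
have -> : p + Q = (antideriv p + antideriv Q)^`() by rewrite derivD !antiderivK.
rewrite /cell0_average cell_average_deriv // !cell_averageE // !hornerD; ring.
Qed.

Lemma cell0_averageZ c p : cell0_average (c *: p) = c * cell0_average p.
Proof. exact: cell_averageZ. Qed.

Lemma cell0_average_ge0 p :
  (forall t, `|t| <= 1 -> 0 <= p.[t]) -> 0 <= cell0_average p.
Proof.
move=> p0; rewrite /cell0_average /cell_average invr1 mul1r.
apply: Rintegral_ge0 => t; rewrite /cell /= in_itv /= => ht.
by apply: p0; rewrite ler_norml; lra.
Qed.

Lemma cell0_average_le p Q : (forall t, `|t| <= 1 -> p.[t] <= Q.[t]) ->
  cell0_average p <= cell0_average Q.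
Proof.
move=> pQ; rewrite -[Q](subrK p) cell0_averageD lerDr.
by apply: cell0_average_ge0 => t ht; rewrite hornerD hornerN subr_ge0 pQ.
Qed.

Lemma cell0_averageC c : cell0_average c%:P = c.
Proof.
have -> : c%:P = (c *: 'X)^`() by rewrite derivZ derivX alg_polyC.
by rewrite /cell0_average cell_average_deriv // !hornerE /=; field.
Qed.

(** The square of a seminorm that vanishes on the constants; it is the
   smoothness indicator on the unit grid. *)
Definition js_seminorm r P : R := \sum_(1 <= l < r) cell0_average (P^`(l) ^+ 2).

(** The weights h^(2l-1) are those for which the indicator is invariant under
   scaling: h^(-2l) comes from the squared derivative and h from the measure. *)
Lemma smoothness_indicator_rescale x h r v (s : 'I_r) P : 0 < h ->
  substencil_poly x h v s = rescale x h P ->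
  smoothness_indicator x h v s = js_seminorm r P.
Proof.
move=> h0 eP; have hn0 : h != 0 by rewrite gt_eqF.
rewrite /smoothness_indicator eP.
apply: eq_big_nat => l /andP[l1 _].
have eP2 : rescale x h (P^`(l) ^+ 2) = h ^+ (2 * l) *: (rescale x h P)^`(l) ^+ 2.
  rewrite derivn_rescale exprZn scalerA exprVn -exprM mulnC mulfV ?expf_neq0 //.
  by rewrite scale1r /rescale !expr2 comp_polyM.
rewrite /cell0_average -(cell_average_rescale x _ _ h0) eP2 cell_averageZ //.
rewrite /cell_average mulrA; congr (_ * _).
  have -> : (2 * l = (2 * l - 1).+1)%N by lia.
  by rewrite exprSr mulfK // subn1.
by apply: eq_Rintegral => y _; rewrite horner_exp.
Qed.

(** A pointwise quadratic inequality may be integrated term by term. *)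
Lemma js_seminorm_perturb r a b T E :
  (forall y z, (y + z) ^+ 2 <= a * y ^+ 2 + b * z ^+ 2) ->
  js_seminorm r (T + E) <= a * js_seminorm r T + b * js_seminorm r E.
Proof.
move=> ab; rewrite /js_seminorm !mulr_sumr -big_split /=; apply: ler_sum => l _.
rewrite -!cell0_averageZ -cell0_averageD; apply: cell0_average_le => t _.
rewrite derivnD horner_exp !hornerD !hornerZ !horner_exp; exact: ab.
Qed.

Lemma js_seminorm_le r P K :
  0 <= K -> (forall l t, (l < r)%N -> `|t| <= 1 -> `|P^`(l).[t]| <= K) ->
  js_seminorm r P <= r%:R * K ^+ 2.
Proof.
move=> K0 PK.
apply: le_trans (_ : \sum_(1 <= l < r) K ^+ 2 <= _).
  apply: ler_sum_nat => l /andP[_ lr]; rewrite -[leRHS]cell0_averageC.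
  apply: cell0_average_le => t ht.
  by rewrite hornerC horner_exp -real_normK ?num_real // lerXn2r ?nnegrE ?PK.
rewrite sumr_const_nat -[leLHS]mulr_natl ler_wpM2r ?sqr_ge0 // ler_nat; lia.
Qed.

Lemma js_seminorm_ge r l P K : (1 <= l < r)%N -> 0 <= K ->
  (forall t, `|t| <= 1 -> K <= `|P^`(l).[t]|) ->
  K ^+ 2 <= js_seminorm r P.
Proof.
move=> /andP[l1 lr] K0 KP.
rewrite /js_seminorm (bigD1_seq l) ?mem_index_iota ?l1 ?lr ?iota_uniq //=.
rewrite ler_wpDr //.
  apply: sumr_ge0 => i _; apply: cell0_average_ge0 => t _.
  by rewrite horner_exp sqr_ge0.
rewrite -[leLHS]cell0_averageC; apply: cell0_average_le => t ht.
by rewrite hornerC horner_exp -[leRHS]real_normK ?num_real // lerXn2r ?nnegrE ?KP.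
Qed.

Definition coef_norm P : R := \sum_(i < size P) `|P`_i|.

Lemma horner_le_coef_norm P t : `|t| <= 1 -> `|P.[t]| <= coef_norm P.
Proof.
move=> t1; rewrite horner_coef; apply: le_trans (ler_norm_sum _ _ _) _.
by apply: ler_sum => i _; rewrite normrM normrX ler_piMr // exprn_ile1.
Qed.

End Seminorm.

(** * Reconstruction of smooth functions *)

Section Smoothness.
Variable R : realType.
Implicit Types (x h y t M : R) (u : R -> R) (n l : nat).

Lemma derivn_taylor l n u x h :
  (taylor n u x h)^`(l) = h ^+ l *: taylor (n - l) (derive1n l u) x h.
Proof.
apply/polyP => i; rewrite coef_derivn coefZ !coef_poly ltn_subRL.
case: ifP => _; last by rewrite mul0rn mulr0.
have -> : derive1n i (derive1n l u) = derive1n (l + i) u.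
  by rewrite /derive1n addnC iterD.
rewrite -(@ffact_fact (l + i) l) ?leq_addr // addKn natrM exprD -mulr_natr.
field; rewrite !pnatr_eq0 -!lt0n fact_gt0 ffact_gt0 leq_addr //.
Qed.

(** For h <= 1 every term after the first contains a factor h. *)
Lemma taylor_const n u x h M t : (0 < n)%N -> 0 <= h <= 1 -> `|t| <= 1 ->
  (forall k, (k < n)%N -> `|derive1n k u x| <= M) ->
  `|(taylor n u x h).[t] - u x| <= n%:R * (M * h).
Proof.
case: n => // n _ /andP[h0 h1] t1 uM.
have M0 : 0 <= M by apply: le_trans (uM 0%N _).
rewrite horner_poly big_ord_recl /= !expr0 !mulr1 fact0 divr1 addrC addKr.
apply: le_trans (ler_norm_sum _ _ _) _.
apply: le_trans (_ : \sum_(k < n) M * h <= _); last first.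
  rewrite sumr_const card_ord -[leLHS]mulr_natl ler_wpM2r ?mulr_ge0 // ler_nat; lia.
apply: ler_sum => k _; rewrite !normrM !normrX normfV !normr_nat (ger0_norm h0).
rewrite -[M * h]mulr1; apply: ler_pM;
  rewrite ?mulr_ge0 ?exprn_ge0 ?invr_ge0 ?exprn_ile1 //.
apply: ler_pM; rewrite ?mulr_ge0 ?exprn_ge0 ?invr_ge0 //.
  rewrite -[M]mulr1; apply: ler_pM; rewrite ?invr_ge0 //.
    exact: (uM k.+1 (ltn_ord k)).
  by rewrite invf_le1 ?ler1n ?ltr0n fact_gt0.
by rewrite exprS ler_piMr // exprn_ile1.
Qed.

(** The stability of reconstruction, with all the derivatives that enter the
   smoothness indicator: the fundamental polynomials are fixed, so their
   coefficients give the constant. *)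
Lemma fundamental_sum_bounded (a : int) n :
  exists2 K : R, 0 <= K & forall v m, 0 <= m ->
    (forall i : 'I_n, `|v (a + i%:Z)| <= m) ->
    forall l t, (l < n)%N -> `|t| <= 1 ->
      `|(fundamental_sum a n v)^`(l).[t]| <= m * K.
Proof.
have cn0 (P : {poly R}) : 0 <= coef_norm P by exact: sumr_ge0.
exists (\sum_(l < n) \sum_(i < n) coef_norm (fundamental R a i)^`(l)).
  by do 2! [apply: sumr_ge0 => ? _].
move=> v m m0 vm l t ln t1.
rewrite (bigD1 (Ordinal ln)) //= mulrDr ler_wpDr //.
  by rewrite mulr_ge0 // sumr_ge0 // => i _; apply: sumr_ge0.
rewrite /fundamental_sum raddf_sum horner_sum mulr_sumr.
apply: le_trans (ler_norm_sum _ _ _) _; apply: ler_sum => i _.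
rewrite [X in `|X.[_]|]derivnZ hornerZ normrM; apply: ler_pM => //.
exact: horner_le_coef_norm.
Qed.

(** On the cells of the stencil, all within distance r h of x, the function u is
   its Taylor polynomial up to M (r h)^n; so are its averages. *)
Lemma reconstruction_taylor u (x0 d M : R) N n (a : int) (r : nat) x h :
  (forall k y, (k < N)%N -> `|y - x0| < d -> derivable (derive1n k u) y 1) ->
  (forall k y, (k <= N)%N -> `|y - x0| < d -> `|derive1n k u y| <= M) ->
  (0 < n <= N)%N -> 0 < h -> `|x - x0| + r%:R * h < d ->
  (forall i : 'I_n, `|a + i%:Z| < r%:Z) ->
  exists2 v : int -> R, forall i : 'I_n, `|v (a + i%:Z)| <= M * (r%:R * h) ^+ n &
    reconstruction x h a n (cell_average x h u) =
    rescale x h (taylor n u x h + fundamental_sum a n v).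
Proof.
move=> du bu /andP[n0 nN] h0 hd ai; have hn0 : h != 0 by rewrite gt_eqF.
pose T := rescale x h (taylor n u x h).
exists (fun k => cell_average x h u k - cell_average x h (horner T) k); last first.
  by apply: reconstruction_perturb => //; exact: size_poly.
move=> i; move: (a + i%:Z) (ai i) => k kr.
have M0 : 0 <= M.
  apply: le_trans (bu 0%N x _ _) => //; apply: le_lt_trans hd.
  by rewrite lerDl mulr_ge0 // ltW.
have cx y : cell x h k y -> `|y - x| <= r%:R * h.
  rewrite /cell /= in_itv /= => /andP[y1 y2].
  have k1 : k%:~R + 1 <= r%:R :> R.
    by rewrite -[1]/(1%:~R) -rmorphD /= -[r%:R]/(r%:~R) ler_int; lia.
  have k2 : - r%:R <= k%:~R - 1 :> R.
    by rewrite -[1]/(1%:~R) -[r%:R]/(r%:~R) -rmorphB -rmorphN /= ler_int; lia.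
  by rewrite ler_norml; nra.
have cd y : cell x h k y -> `|y - x0| < d.
  move=> /cx yx; apply: le_lt_trans hd.
  rewrite (_ : y - x0 = (x - x0) + (y - x)); last by ring.
  by apply: le_trans (ler_normD _ _) _; rewrite lerD2l.
apply: cell_average_dist => // y cy; first exact: (du 0%N y (leq_trans n0 nN) (cd y cy)).
rewrite horner_taylor //.
apply: le_trans (taylor_remainder (x0 := x0) (d := d) (M := M) _ _ _ _) _.
- by move=> l z ln; apply: du; exact: leq_trans ln nN.
- by move=> z; apply: bu.
- by apply: le_lt_trans hd; rewrite lerDl mulr_ge0 // ltW.
- exact: cd.
- by rewrite ler_wpM2l // lerXn2r ?cx // nnegrE // mulr_ge0 // ltW.
Qed.

End Smoothness.

(** * Equivalence of the smoothness indicators *)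

Section Indicators.
Variable R : realType.
Implicit Types (x h y t M e : R) (u : R -> R) (n l : nat).

Lemma sqrD_le e y z : 0 < e ->
  (y + z) ^+ 2 <= (1 + e) * y ^+ 2 + (1 + e^-1) * z ^+ 2.
Proof.
move=> e0; rewrite -subr_ge0.
have -> : (1 + e) * y ^+ 2 + (1 + e^-1) * z ^+ 2 - (y + z) ^+ 2
          = (e * y - z) ^+ 2 / e by field; rewrite gt_eqF.
by rewrite divr_ge0 ?sqr_ge0 // ltW.
Qed.

(** The upper bound perturbs T by E, the lower one perturbs T + E by - E. *)
Lemma js_seminorm_close r (T E : {poly R}) e : 0 < e ->
  (1 + e^-1) * js_seminorm r E <= e * js_seminorm r T ->
  (1 + e^-1) * js_seminorm r (- E) <= e * js_seminorm r T ->
  (1 - 2 * e) * js_seminorm r T <= js_seminorm r (T + E)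
    <= (1 + 2 * e) * js_seminorm r T.
Proof.
move=> e0 hE hNE.
have up := js_seminorm_perturb r T E (fun y z => sqrD_le y z e0).
have := js_seminorm_perturb r (T + E) (- E) (fun y z => sqrD_le y z e0).
rewrite addrK => lo.
have T0 : 0 <= js_seminorm r T.
  by apply: sumr_ge0 => l _; apply: cell0_average_ge0 => t _; rewrite horner_exp sqr_ge0.
move: (js_seminorm r T) (js_seminorm r (T + E)) up lo hE hNE T0 => B b up lo hE hNE T0.
apply/andP; split; last by lra.
have e1 : 0 < 1 + e by lra.
rewrite -(ler_pM2l e1); nra.
Qed.

(** The derivative of order m + 1 of the Taylor polynomial is h^(m+1) times the
   Taylor polynomial of that derivative, which for small h is nearly constant on
   [-1, 1]. *)
Lemma taylor_derivn_ge r m u x h M c : (m.+1 < r)%N -> 0 < h <= 1 ->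
  (forall k, (k < r)%N -> `|derive1n k u x| <= M) ->
  2 * c <= `|derive1n m.+1 u x| -> r%:R * (M * h) <= c ->
  forall t, `|t| <= 1 -> h ^+ m.+1 * c <= `|(taylor r u x h)^`(m.+1).[t]|.
Proof.
move=> mr /andP[h0 h1] uM c0 hc t t1.
have M0 : 0 <= M by apply: le_trans (uM 0%N _); rewrite // ltnW // (leq_ltn_trans _ mr).
rewrite derivn_taylor hornerZ normrM (ger0_norm (exprn_ge0 _ (ltW h0))).
rewrite ler_wpM2l ?exprn_ge0 ?(ltW h0) //.
have := @taylor_const _ (r - m.+1) (derive1n m.+1 u) x h M t.
move=> /(_ _ _ t1); rewrite subn_gt0 mr (ltW h0) h1 => /(_ isT isT) H.
have {H} : `|(taylor (r - m.+1) (derive1n m.+1 u) x h).[t] - derive1n m.+1 u x| <= c.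
  apply: le_trans (H _) _.
    move=> k kr; have -> : derive1n k (derive1n m.+1 u) = derive1n (k + m.+1) u.
      by rewrite /derive1n iterD.
    by apply: uM; lia.
  apply: le_trans hc; rewrite ler_wpM2r ?mulr_ge0 ?(ltW h0) // ler_nat; lia.
move: (horner _ _) (derive1n _ _ _) c0 => p q c0; rewrite distrC => qp.
have := ler_normB (q - p) (- p).
by rewrite opprK subrK normrN; lra.
Qed.

(** The seminorm of T is at least of the order of h^(m+1) and the perturbations
   are of the order of h^r, where r > m + 1. *)
Lemma smoothness_indicators_close r m u x0 (dl : R) : (m < r - 1)%N ->
  smooth_near (2 * r - 1) u x0 -> critical_point_order u x0 m -> 0 < dl ->
  exists2 eta : R, 0 < eta & forall h x, 0 < h < eta -> `|x - x0| < eta ->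
    exists2 B, 0 < B & forall s : 'I_r,
      (1 - dl) * B <= smoothness_indicator x h (cell_average x h u) s
        <= (1 + dl) * B.
Proof.
move=> mr; have mr1 : (m.+1 < r)%N by lia.
have ltN k : (k < r)%N -> (k < 2 * r - 1)%N by lia.
have r_gt0 : (0 < r)%N by lia.
have rN : (0 < r <= 2 * r - 1)%N by lia.
have cells (s i : 'I_r) : `|(s%:Z - r%:Z + 1) + i%:Z| < r%:Z.
  by have := ltn_ord s; have := ltn_ord i; lia.
have expo : ((m.+1 * 2).+1 <= r * 2)%N by lia.
move=> sn [_ un0] dl0.
have [d [M [d0 M0 du bu]]] := smooth_near_bounded sn.
pose c := `|derive1n m.+1 u x0| / 4.
have c0 : 0 < c by rewrite divr_gt0 ?normr_gt0.
have [d' /= d'0 cu] : exists2 d' : R, 0 < d' &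
    forall x, `|x - x0| < d' -> 2 * c <= `|derive1n m.+1 u x|.
  have : {for x0, continuous (derive1n m.+1 u)}.
    apply: differentiable_continuous; apply/derivable1_diffP.
    by apply: du; [exact: ltN|rewrite subrr normr0].
  move=> /cvgrPdist_lt /(_ (2 * c)); rewrite mulr_gt0 // => /(_ isT).
  move=> /nbhs_ballP[d' /= d'0 hd']; exists d' => // x; rewrite distrC => /hd' /= ux.
  have e4 : `|derive1n m.+1 u x0| = 4 * c by rewrite /c; field.
  have := ler_normD (derive1n m.+1 u x0 - derive1n m.+1 u x) (derive1n m.+1 u x).
  by rewrite subrK e4; lra.
have /choice[K hK] : forall s : 'I_r, exists K : R, 0 <= K /\ forall v m, 0 <= m ->
    (forall i : 'I_r, `|v ((s%:Z - r%:Z + 1) + i%:Z)| <= m) ->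
    forall l t, (l < r)%N -> `|t| <= 1 ->
      `|(fundamental_sum (s%:Z - r%:Z + 1) r v)^`(l).[t]| <= m * K.
  by move=> s; have [K K0 hK] := fundamental_sum_bounded R (s%:Z - r%:Z + 1) r; exists K.
pose Ks := \sum_s K s.
have KKs s : K s <= Ks.
  by rewrite /Ks (bigD1 s) //= lerDl sumr_ge0 // => i _; case: (hK i).
have Ks0 : 0 <= Ks by apply: sumr_ge0 => i _; case: (hK i).
pose e := dl / 2; have e0 : 0 < e by rewrite divr_gt0.
pose C := r%:R * (M * r%:R ^+ r * Ks) ^+ 2.
have C0 : 0 <= C by rewrite mulr_ge0 ?sqr_ge0.
have r0 : 0 < r%:R :> R by rewrite ltr0n.
(* In this order: h <= 1; the derivative of order m + 1 stays away from 0; the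
   stencil stays where u is smooth; T dominates its terms of higher order; the
   perturbation is at most e times the seminorm of T. *)
pose eta := Num.min (Num.min 1 d') (Num.min (d / (r%:R + 1))
  (Num.min (c / (r%:R * M)) (e * c ^+ 2 / ((1 + e^-1) * C + 1)))).
have ei0 : 0 < e^-1 by rewrite invr_gt0.
have D0 : 0 < (1 + e^-1) * C + 1 by rewrite ltr_wpDl // mulr_ge0 //; lra.
have r1 : 0 < r%:R + 1 :> R by lra.
exists eta.
  have a1 : 0 < d / (r%:R + 1) by exact: divr_gt0.
  have a2 : 0 < c / (r%:R * M) by apply: divr_gt0 => //; exact: mulr_gt0.
  have a3 : 0 < e * c ^+ 2 / ((1 + e^-1) * C + 1).
    by apply: divr_gt0 => //; rewrite mulr_gt0 // exprn_gt0.
  by rewrite !lt_min ltr01 d'0 a1 a2 a3.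
move=> h x /andP[h0]; rewrite !lt_min => /andP[/andP[h1 _] /and3P[hd hM hC]].
move=> /andP[/andP[_ xd'] /and3P[xd _ _]].
have xhd : `|x - x0| + r%:R * h < d.
  by move: xd hd; rewrite !ltr_pdivlMr //; nra.
have xd1 : `|x - x0| < d by apply: le_lt_trans xhd; rewrite lerDl mulr_ge0 // ltW.
have uMx k : (k < r)%N -> `|derive1n k u x| <= M.
  by move=> kr; apply: bu; rewrite // ltnW // ltN.
pose T := taylor r u x h.
have TB : (h ^+ m.+1 * c) ^+ 2 <= js_seminorm r T.
  apply: (@js_seminorm_ge _ r m.+1) => //; first by rewrite mulr_ge0 ?exprn_ge0 // ltW.
  apply: (taylor_derivn_ge (M := M)) => //; first by rewrite h0 ltW.
    exact: cu.
  by move: hM; rewrite ltr_pdivlMr ?mulr_gt0 //; nra.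
exists (js_seminorm r T).
  by apply: lt_le_trans TB; rewrite exprn_gt0 // mulr_gt0 // exprn_gt0.
move=> s; set v := cell_average x h u.
have [f fM fE] : exists2 f : int -> R,
    forall i : 'I_r, `|f ((s%:Z - r%:Z + 1) + i%:Z)| <= M * (r%:R * h) ^+ r &
    reconstruction x h (s%:Z - r%:Z + 1) r v =
    rescale x h (T + fundamental_sum (s%:Z - r%:Z + 1) r f).
  apply: (reconstruction_taylor du bu) => // i; exact: cells.
rewrite (smoothness_indicator_rescale h0 fE).
set E := fundamental_sum _ _ _ in fE *.
have Mh0 : 0 <= M * (r%:R * h) ^+ r.
  by rewrite mulr_ge0 ?exprn_ge0 ?mulr_ge0 // ltW.
have EK l t : (l < r)%N -> `|t| <= 1 -> `|E^`(l).[t]| <= M * (r%:R * h) ^+ r * Ks.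
  move=> lr t1; apply: le_trans ((hK s).2 f _ Mh0 fM l t lr t1) _.
  by rewrite ler_wpM2l.
have small : (1 + e^-1) * (r%:R * (M * (r%:R * h) ^+ r * Ks) ^+ 2) <= e * js_seminorm r T.
  apply: le_trans (_ : e * (h ^+ m.+1 * c) ^+ 2 <= _); last by rewrite ler_wpM2l // ltW.
  have -> : r%:R * (M * (r%:R * h) ^+ r * Ks) ^+ 2 = C * h ^+ r ^+ 2.
    by rewrite /C [(r%:R * h) ^+ r]exprMn; ring.
  have hr : h ^+ r ^+ 2 <= h * (h ^+ m.+1) ^+ 2.
    rewrite -!exprM -exprS; apply: ler_wiXn2l; [exact: ltW|exact: ltW|exact: expo].
  have h2 : 0 <= (h ^+ m.+1) ^+ 2 by rewrite sqr_ge0.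
  have e1 : 0 < 1 + e^-1 by lra.
  have hC' : (1 + e^-1) * C * h <= e * c ^+ 2.
    by move: hC; rewrite ltr_pdivlMr //; nra.
  apply: le_trans (_ : (1 + e^-1) * (C * (h * (h ^+ m.+1) ^+ 2)) <= _).
    by rewrite ler_wpM2l ?(ltW e1) // ler_wpM2l.
  have -> : (1 + e^-1) * (C * (h * (h ^+ m.+1) ^+ 2))
          = ((1 + e^-1) * C * h) * (h ^+ m.+1) ^+ 2.
    by ring.
  have -> : e * (h ^+ m.+1 * c) ^+ 2 = (e * c ^+ 2) * (h ^+ m.+1) ^+ 2 by ring.
  exact: ler_wpM2r.
have sm E' : (forall l t, (l < r)%N -> `|t| <= 1 ->
      `|E'^`(l).[t]| <= M * (r%:R * h) ^+ r * Ks) ->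
    (1 + e^-1) * js_seminorm r E' <= e * js_seminorm r T.
  move=> E'K; apply: le_trans small; rewrite ler_wpM2l //; first by lra.
  by apply: js_seminorm_le => //; rewrite mulr_ge0.
have -> : dl = 2 * e by rewrite /e; field.
apply: js_seminorm_close => //; apply: sm => // l t lr t1.
by rewrite derivnN hornerN normrN EK.
Qed.

End Indicators.

(** * Weights and mapping *)

Section Weights.
Variable R : realType.
Implicit Types (x h : R) (v : int -> R) (r n : nat).

(** Normalization forgets a common factor of the b s, so only their ratios to B
   matter. *)
Lemma normalized_weights_close r (d b : 'I_r -> R) (B dl : R) s :
  (forall s, 0 < d s) -> \sum_s d s = 1 -> 0 < B -> 0 < dl <= 2^-1 ->
  (forall s, (1 - dl) * B <= b s <= (1 + dl) * B) ->
  `|normalize_weights (fun s => d s / b s ^+ 2) s - d s| <= 16 * dl.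
Proof.
move=> d0 d1 B0 /andP[dl0 dl2] bB; rewrite /normalize_weights.
have lo0 : 0 < (1 - dl) * B by rewrite mulr_gt0 //; lra.
have up0 : 0 < (1 + dl) * B by rewrite mulr_gt0 //; lra.
have b0 i : 0 < b i by have /andP[+ _] := bB i; apply: lt_le_trans.
set X := ((1 + dl) * B) ^- 2; set Y := ((1 - dl) * B) ^- 2.
have aX i : X <= (b i ^+ 2)^-1.
  have /andP[_ ?] := bB i.
  by rewrite lef_pV2 ?posrE ?exprn_gt0 // lerXn2r ?nnegrE // ltW.
have aY i : (b i ^+ 2)^-1 <= Y.
  have /andP[? _] := bB i.
  by rewrite lef_pV2 ?posrE ?exprn_gt0 // lerXn2r ?nnegrE // ltW.
have X0 : 0 < X by rewrite invr_gt0 exprn_gt0.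
have XY : X * (1 + dl) ^+ 2 = Y * (1 - dl) ^+ 2.
  by rewrite /X /Y; field; rewrite !gt_eqF //; lra.
set S := \sum_(l < r) _.
have SX : X <= S.
  rewrite -[X]mul1r -d1 mulr_suml; apply: ler_sum => i _.
  by rewrite ler_wpM2l // ltW.
have SY : S <= Y.
  rewrite -[Y]mul1r -d1 mulr_suml; apply: ler_sum => i _.
  by rewrite ler_wpM2l // ltW.
have S0 : 0 < S by apply: lt_le_trans SX.
have ds1 : d s <= 1.
  by rewrite -d1 (bigD1 s) //= lerDl; apply: sumr_ge0 => i _; exact: ltW.
have ds0 := d0 s.
have q4 : 4^-1 <= (1 - dl) ^+ 2 by nra.
have YX : d s * Y <= (d s + 16 * dl) * X.
  have q0 : 0 < (1 - dl) ^+ 2 by lra.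
  rewrite -(ler_pM2r q0) -mulrA -XY [leRHS]mulrAC mulrA -[leLHS]mulrAC ler_pM2r //.
  nra.
have XY' : (d s - 16 * dl) * Y <= d s * X.
  have q0 : 0 < (1 - dl) ^+ 2 by lra.
  rewrite -(ler_pM2r q0) -mulrA -XY mulrA -[leLHS]mulrAC [leRHS]mulrAC ler_pM2r //.
  nra.
have aXs : d s * X <= d s / b s ^+ 2 by rewrite ler_pM2l.
have aYs : d s / b s ^+ 2 <= d s * Y by rewrite ler_pM2l.
rewrite ler_distl ler_pdivrMr // ler_pdivlMr //; apply/andP; split; last first.
  apply: le_trans aYs (le_trans YX _); rewrite ler_pM2l //; lra.
apply: le_trans _ aXs.
have [n|p] := leP (d s - 16 * dl) 0.
  apply: le_trans (_ : 0 <= _); last by rewrite mulr_ge0 // ltW.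
  exact: mulr_le0_ge0 n (ltW S0).
by apply: le_trans XY'; rewrite ler_pM2l.
Qed.

(** The plateaus are disjoint, and the strict inequalities put dt_i in the interior
   of the i-th one. *)
Lemma acm_map_plateau r (dt : seq R) (CFS0 CFS1 k0 k1 : R) i :
  sorted <%R dt -> size dt = r -> CFS0 < dt`_0 -> dt`_r.-1 < CFS1 -> (i < r)%N ->
  exists2 eta : R, 0 < eta &
    forall w, `|w - dt`_i| < eta -> acm_map r dt CFS0 CFS1 k0 k1 w = dt`_i.
Proof.
move=> sdt sz h0 h1 ir.
have mono a b : (a <= b)%N -> (b < r)%N -> dt`_a <= dt`_b.
  move=> ab br; rewrite (lt_sorted_leq_nth 0 sdt) ?inE ?sz //.
  exact: leq_ltn_trans br.
have smono a : (a.+1 < r)%N -> dt`_a < dt`_a.+1.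
  by move=> ar; rewrite (lt_sorted_ltn_nth 0 sdt) ?inE ?sz // ltnW.
(* The distances from dt_i to the ends of its plateau. *)
pose gl := if i == 0%N then dt`_0 - CFS0 else (dt`_i - dt`_i.-1) / 2.
pose gr := if i == r.-1 then CFS1 - dt`_r.-1 else (dt`_i.+1 - dt`_i) / 2.
have gl0 : 0 < gl.
  rewrite /gl; case: (i) ir => [|j] jr /=; first by lra.
  by have := smono _ jr; lra.
have gr0 : 0 < gr.
  rewrite /gr; case: eqP => [_|/eqP ir1]; first by lra.
  have /smono ? : (i.+1 < r)%N by lia.
  lra.
exists (Num.min gl gr); first by rewrite lt_min gl0.
move=> w; rewrite lt_min !ltr_norml => /andP[/andP[wl _] /andP[_ wr]].
have CFS0w : CFS0 <= w.
  have : CFS0 <= dt`_i - gl; last by lra.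
  rewrite /gl; case: (i) ir => [|j] jr /=; first by lra.
  by have := smono _ jr; have := mono 0%N j (leq0n _) (ltnW jr); lra.
have mid_w j : (j < i)%N -> (dt`_j + dt`_j.+1) / 2 <= w.
  move=> ji; have i0 : (i == 0%N) = false by case: (i) ji.
  have i1 : (i.-1.+1 = i)%N by case: (i) ji.
  move: wl; rewrite /gl i0.
  have := mono j i.-1; have := mono j.+1 i ji ir.
  by rewrite -ltnS i1 => ? /(_ ji (ltnW ir)); lra.
have w_mid j : (i <= j)%N -> (j.+1 < r)%N -> w < (dt`_j + dt`_j.+1) / 2.
  move=> ij jr; move: wr; rewrite /gr ltn_eqF; last by lia.
  have := mono i j ij (ltnW jr); have := mono i.+1 j.+1 ij jr; lra.
rewrite /acm_map ltNge CFS0w /=.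
(* The picked plateau has to be the i-th one, as w lies strictly between the
   midpoints around dt_i. *)
case: pickP => [j wj|/(_ (Ordinal ir))].
  case: (ltngtP i j) => [ij|ji|->] //.
    move: wj; rewrite /acm_plateau /= itv_boundlr /= => /andP[+ _].
    rewrite gtn_eqF ?(leq_ltn_trans _ ij) //= bnd_simp.
    have := w_mid j.-1; rewrite (ltn_predK ij) -ltnS (ltn_predK ij) ij.
    by move=> /(_ isT (ltn_ord j)) ? ?; lra.
  move: wj; rewrite /acm_plateau /= itv_boundlr /= => /andP[_].
  have -> : (j == r.-1 :> nat) = false by apply/negbTE; lia.
  by rewrite bnd_simp => ?; have := mid_w j ji; lra.
rewrite /acm_plateau /= itv_boundlr => /negP[]; apply/andP; split.
  case: eqP => [_|/eqP i0]; rewrite bnd_simp //.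
  have := mid_w i.-1; rewrite prednK ?lt0n //; exact.
case: eqP => [ir1|/eqP ir1]; rewrite bnd_simp.
  by move: wr; rewrite /gr ir1 eqxx; lra.
by apply: w_mid; lia.
Qed.

End Weights.

(** * Accuracy of the scheme *)

Section Scheme.
Variable R : realType.
Implicit Types (x h : R) (v : int -> R) (r n : nat) (u : R -> R).

(** The defining identity of the ideal weights, for a constant function. *)
Lemma ideal_weights_sum r (d : 'I_r -> R) : (0 < r)%N -> ideal_weights d ->
  \sum_s d s = 1.
Proof.
move=> r0 hd.
have rec1 a n : (0 < n)%N ->
    (reconstruction 0 1 a n (cell_average 0 1 (horner (1%:P : {poly R})))).[0 + 1 / 2] = 1.
  by move=> n0; rewrite reconstruction_poly // ?hornerC // size_polyC oner_eq0.
have := hd 0 1 (cell_average 0 1 (horner (1%:P : {poly R}))) ltr01.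
rewrite /stencil_poly rec1; last by lia.
move=> <-; apply: eq_bigr => s _.
by rewrite /substencil_value /substencil_poly rec1 // mulr1.
Qed.

Lemma size_sorted_weights r (d : 'I_r -> R) : size (sorted_weights d) = r.
Proof. by rewrite size_sort size_map size_enum_ord. Qed.

Lemma sorted_weights_nth r (d : 'I_r -> R) s :
  exists2 i, (i < r)%N & (sorted_weights d)`_i = d s.
Proof.
have : d s \in sorted_weights d by rewrite mem_sort map_f // mem_enum.
by move=> /(nthP 0)[i]; rewrite size_sorted_weights => ir e; exists i.
Qed.

(** Replacing u by its Taylor polynomial changes both the point value and the
   reconstructed value by O(h^(2r-1)). *)
Lemma stencil_poly_error r u x0 : (0 < r)%N -> smooth_near (2 * r - 1) u x0 ->
  exists C, exists2 eta : R, 0 < eta & forall h x, 0 < h < eta -> `|x - x0| < eta ->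
    `|(stencil_poly x h r (cell_average x h u)).[x + h / 2] - u (x + h / 2)|
      <= C * h ^+ (2 * r - 1).
Proof.
move=> r0; have N0 : (0 < 2 * r - 1)%N by lia.
have cells (i : 'I_(2 * r - 1)) : `|(1 - r%:Z) + i%:Z| < r%:Z.
  by have := ltn_ord i; lia.
move=> sn.
have [d [M [d0 M0 du bu]]] := smooth_near_bounded sn.
have [K K0 hK] := fundamental_sum_bounded R (1 - r%:Z) (2 * r - 1).
have r1 : 1 <= r%:R :> R by rewrite ler1n.
exists (M * r%:R ^+ (2 * r - 1) * K + M); exists (d / (r%:R + 1)).
  by rewrite divr_gt0 //; lra.
move=> h x /andP[h0 hd] xd.
have r2 : 0 < r%:R + 1 :> R by lra.
have xhd : `|x - x0| + r%:R * h < d.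
  by move: xd hd; rewrite !ltr_pdivlMr //; nra.
have N0' : (0 < 2 * r - 1 <= 2 * r - 1)%N by rewrite N0 leqnn.
have [v vM vE] := reconstruction_taylor du bu N0' h0 xhd cells.
rewrite /stencil_poly vE /rescale comp_polyD -/(rescale x h _) -/(rescale x h _) hornerD.
rewrite addrAC addrC mulrDl; apply: le_trans (ler_normD _ _) _; apply: lerD.
  rewrite -[h / 2]mulrC horner_rescale ?gt_eqF //.
  have t1 : `|2^-1 : R| <= 1 by rewrite ger0_norm; lra.
  have Mh0 : 0 <= M * (r%:R * h) ^+ (2 * r - 1).
    by rewrite mulr_ge0 ?exprn_ge0 ?mulr_ge0 // ltW.
  apply: le_trans (hK v _ Mh0 vM 0%N 2^-1 N0 t1) _.
  by rewrite exprMn le_eqVlt; apply/orP; left; apply/eqP; ring.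
rewrite distrC horner_taylor ?gt_eqF //.
have xh0 : `|x + h / 2 - x0| < d.
  rewrite (_ : x + h / 2 - x0 = (x - x0) + h / 2); last by ring.
  apply: le_lt_trans (ler_normD _ _) _; rewrite [`|h / 2|]ger0_norm; last by lra.
  by nra.
apply: le_trans (taylor_remainder (x0 := x0) (d := d) (M := M) _ _ _ xh0) _.
- by move=> k y kn; apply: du.
- by move=> y; apply: bu.
- by apply: le_lt_trans xhd; rewrite lerDl mulr_ge0 // ltW.
rewrite [x + _]addrC addrK ler_wpM2l ?(ltW M0) // lerXn2r ?nnegrE ?(ltW h0) //.
rewrite ger0_norm; lra.
Qed.

(** Adding eps to indicators that are nearly proportional to B gives quantities
   that are nearly proportional to eps + B; hence a tolerance dl that is uniform
   in eps. *)
Lemma acm_weights_eq_ideal r (d : 'I_r -> R) (CFS0 CFS1 k0 k1 : R) :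
  ideal_weights d -> sorted <%R (sorted_weights d) -> 0 < CFS0 ->
  CFS0 < (sorted_weights d)`_0 -> (sorted_weights d)`_r.-1 < CFS1 ->
  exists2 dl : R, 0 < dl & forall (x h : R) v B, 0 < B ->
    (forall s : 'I_r, (1 - dl) * B <= smoothness_indicator x h v s <= (1 + dl) * B) ->
    forall eps : R, 0 < eps -> acm_weights d CFS0 CFS1 k0 k1 eps x h v = d.
Proof.
move=> hd sd C0 h0 h1.
have [r0|r0] := posnP r.
  exists 1 => // x h v B _ _ eps _; apply/funext => s.
  by have := ltn_ord s; rewrite {2}r0.
have d1 := ideal_weights_sum r0 hd.
have dpos s : 0 < d s.
  have [i ir <-] := sorted_weights_nth d s; apply: lt_le_trans (lt_trans C0 h0) _.
  by rewrite (lt_sorted_leq_nth 0 sd) ?inE ?size_sorted_weights.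
have /choice[eta heta] : forall s, exists eta : R, 0 < eta /\
    forall w, `|w - d s| < eta ->
    acm_map r (sorted_weights d) CFS0 CFS1 k0 k1 w = d s.
  move=> s; have [i ir <-] := sorted_weights_nth d s.
  have [eta e0 he] := acm_map_plateau k0 k1 sd (size_sorted_weights d) h0 h1 ir.
  by exists eta.
(* 1 / z is a lower bound of 1 and of all the eta s. *)
pose z := 1 + \sum_s (eta s)^-1.
have ei s : 0 <= (eta s)^-1 by rewrite invr_ge0 ltW //; case: (heta s).
have z1 : 1 <= z by rewrite lerDl sumr_ge0.
have z0 : 0 < z := lt_le_trans ltr01 z1.
have ez s : z^-1 <= eta s.
  have [es0 _] := heta s.
  rewrite -[eta s]invrK lef_pV2 ?posrE ?invr_gt0 //.
  apply: le_trans (_ : \sum_s (eta s)^-1 <= _); last by rewrite lerDr.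
  by rewrite (bigD1 s) //= lerDl sumr_ge0.
have zi0 : 0 < z^-1 by rewrite invr_gt0.
have zi1 : z^-1 <= 1 by rewrite invf_le1.
exists (z^-1 / 32); first by rewrite divr_gt0.
move=> x h v B B0 bB eps eps0.
have accm s : acm_map r (sorted_weights d) CFS0 CFS1 k0 k1
    (js_weights d eps x h v s) = d s.
  apply: (heta s).2.
  apply: le_lt_trans (normalized_weights_close s dpos d1 (B := eps + B)
    (dl := z^-1 / 32) _ _ _) _.
  - lra.
  - by apply/andP; split; lra.
  - by move=> t; have /andP[? ?] := bB t; apply/andP; split; nra.
  - by have := ez s; lra.
apply/funext => s; rewrite /acm_weights /normalize_weights accm.
under eq_bigr do rewrite accm.
by rewrite d1 divr1.
Qed.
End Scheme.

Theorem theorem2 (R : realType) (r : nat) (d : 'I_r -> R)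
  (CFS0 CFS1 k0 k1 : R)
  (hd : ideal_weights d)
  (hsorted : sorted <%R (sorted_weights d))
  (hCFS0_gt0 : 0 < CFS0)
  (hCFS0 : CFS0 < (sorted_weights d)`_0)
  (hCFS1 : (sorted_weights d)`_r.-1 < CFS1)
  (hCFS1_le1 : CFS1 <= 1)
  (hk0 : 0 <= k0 <= (sorted_weights d)`_0 / CFS0)
  (hk1_ge0 : 0 <= k1)
  (hk1 : CFS1 < 1 -> k1 <= (1 - (sorted_weights d)`_r.-1) / (1 - CFS1)) :
  forall ncp : nat, (ncp < r - 1)%N ->
  forall (u : R -> R) (x0 : R),
    smooth_near (2 * r - 1) u x0 ->
    critical_point_order u x0 ncp ->
    exists C : R, \forall h \near (0 : R)^'+ & x \near x0,
      forall eps : R, 0 < eps ->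
        `|mop_weno_acmk d CFS0 CFS1 k0 k1 eps u x h - u (x + h / 2)|
          <= C * h ^+ (2 * r - 1).
Proof.
move=> m mr u x0 sn cp.
have r0 : (0 < r)%N by lia.
have [dl dl0 hw] := acm_weights_eq_ideal k0 k1 hd hsorted hCFS0_gt0 hCFS0 hCFS1.
have [eta eta0 heta] := smoothness_indicators_close mr sn cp dl0.
have [C [eta' eta'0 hC]] := stencil_poly_error r0 sn.
exists C.
pose e := Num.min eta eta'.
have e0 : 0 < e by rewrite lt_min eta0.
exists ([set h | 0 < h < e], [set x | `|x - x0| < e]).
  split => /=.
    near=> h => /=; apply/andP; split; near: h.
      exact: nbhs_right_gt.
    exact: nbhs_right_lt.
  by apply/nbhs_ballP; exists e => // x; rewrite /ball /= distrC.
move=> [h x] /= [/andP[h0]]; rewrite !lt_min => /andP[he he'] /andP[xe xe'] eps eps0.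
have he1 : 0 < h < eta by rewrite h0.
have he2 : 0 < h < eta' by rewrite h0.
have [B B0 hB] := heta h x he1 xe.
rewrite /mop_weno_acmk (hw x h _ B B0 hB eps eps0) /weno_value hd //.
exact: hC.
Unshelve. all: by end_near.
Qed.
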